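(* Let $a\neq 0,1$, let $c$ be a parameter (a complex number), and let $\mathcal F=(F_1,F_2)$ be a pair of finite sets of nonnegative integers. Then, as polynomials in $x$, $$\mathtt{M}_{\mathcal F,x}^{a,c}=(-1)^{w_{\mathcal F}}\,\mathtt{M}_{I(\mathcal F),-x}^{a,\,-c-\max F_1-\max F_2}.$$
   Context: For $a\neq 0,1$ the Meixner polynomials are $$m_n^{a,c}(x)=\frac{a^n}{(1-a)^n}\sum_{j=0}^n a^{-j}\binom{x}{j}\binom{-x-c}{n-j},\qquad n\ge 0,$$ where $\binom{y}{j}=y(y-1)\cdots(y-j+1)/j!$. Let $\mathcal F=(F_1,F_2)$ be a pair of finite sets of nonnegative integers, where $F_i$ has $k_i$ elements, and put $k=k_1+k_2$. The (normalized) quasi Casorati-Meixner determinant is $$\mathtt{M}_{\mathcal F,x}^{a,c}=\frac{\det A}{a^{\binom{k_2}{2}-k_2(k-1)}(1-a)^{k_1k_2}},$$ where $A$ is the $k\times k$ matrix whose first $k_1$ rows are indexed by $f\in F_1$ (in increasing order), with entries $m_f^{a,c}(x+j-1)$, $1\le j\le k$, and whose last $k_2$ rows are indexed by $f\in F_2$ (in increasing order), with entries $m_f^{1/a,c}(x+j-1)/a^{j-1}$, $1\le j\le k$. It is a polynomial in $x$; the subscript $-x$ means evaluation of this polynomial at $-x$. For $\mathtt{M}_{I(\mathcal F),\cdot}$, the numbers $k_1,k_2,k$ are those of the pair $I(\mathcal F)$. For a finite set $F$ of nonnegative integers with $|F|$ elements, $$w_F=\sum_{f\in F}f-\binom{|F|}{2},\qquad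 I(F)=\{0,1,\dots,\max F\}\setminus\{\max F-f:f\in F\},$$ and for the pair, $w_{\mathcal F}=w_{F_1}+w_{F_2}$ and $I(\mathcal F)=(I(F_1),I(F_2))$. Conventions: the determinant of an empty matrix is $1$; $\max\emptyset=-1$, so that $I(\emptyset)=\emptyset$. *)

(* Defs.v *)
From HB Require Import structures.
From mathcomp Require Import all_boot all_order all_algebra.
From mathcomp Require Import finmap.
Set Implicit Arguments.
Unset Strict Implicit.
Unset Printing Implicit Defensive.
Import GRing.Theory.
Local Open Scope ring_scope.

(* The paper's variable x is the indeterminate 'X. *)
Section Meixner.
Variable K : fieldType.
Implicit Types (a c : K) (p : {poly K}).

(* p (p - 1) ... (p - j + 1) / j! *)
Definition pbinom p (j : nat) : {poly K} :=
  (j`!%:R)^-1 *: \prod_(i < j) (p - i%:R).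

Definition meixner a c (n : nat) : {poly K} :=
  (a ^+ n / (1 - a) ^+ n) *:
    \sum_(j < n.+1) a ^- j *: (pbinom 'X j * pbinom (- 'X - c%:P) (n - j)).

(* The i-th smallest element of F, counting from 0. *)
Definition fset_nth (F : {fset nat}) (i : nat) : nat :=
  nth 0%N (sort leq (enum_fset F)) i.

(* Columns are counted from 0, so the shift x + j - 1 becomes x + j. *)
Definition casorati_mx a c (F1 F2 : {fset nat}) :
    'M[{poly K}]_(#|` F1| + #|` F2|) :=
  col_mx
    (\matrix_(i < #|` F1|, j < #|` F1| + #|` F2|)
       (meixner a c (fset_nth F1 i) \Po ('X + j%:R)))
    (\matrix_(i < #|` F2|, j < #|` F1| + #|` F2|)
       (a ^- j *: (meixner a^-1 c (fset_nth F2 i) \Po ('X + j%:R)))).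

(* The exponent of a is an integer, possibly negative. *)
Definition quasi_casorati_meixner a c (F : {fset nat} * {fset nat}) :
    {poly K} :=
  let k1 := #|` F.1| in let k2 := #|` F.2| in let k := (k1 + k2)%N in
  (a ^ ('C(k2, 2)%:Z - k2%:Z * (k%:Z - 1)) * (1 - a) ^+ (k1 * k2))^-1 *:
    \det (casorati_mx a c F.1 F.2).

End Meixner.

Definition fset_max (F : {fset nat}) : int :=
  if F == fset0 then -1 else (\max_(f <- enum_fset F) f)%N%:Z.

Definition weight (F : {fset nat}) : int :=
  (\sum_(f <- enum_fset F) f)%N%:Z - 'C(#|` F|, 2)%:Z.

Definition weight_pair (F : {fset nat} * {fset nat}) : int :=
  weight F.1 + weight F.2.

(* The test on F is needed because the bigop \max gives 0, not -1, on fset0;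
   subtraction of naturals is exact here since f <= M. *)
Definition invol (F : {fset nat}) : {fset nat} :=
  let M := (\max_(f <- enum_fset F) f)%N in
  if F == fset0 then fset0
  else ([fset n in iota 0 M.+1] `\` [fset (M - f)%N | f in F])%fset.

Definition invol_pair (F : {fset nat} * {fset nat}) :
    {fset nat} * {fset nat} := (invol F.1, invol F.2).

(* Main.v *)
Require Import Defs.
From HB Require Import structures.
From mathcomp Require Import all_boot all_order all_algebra.
From mathcomp Require Import perm finmap reals complex.
From mathcomp Require Import ring zify.
Set Implicit Arguments.
Unset Strict Implicit.
Unset Printing Implicit Defensive.
Import GRing.Theory.
Local Open Scope ring_scope.

(** With p = 1 / (1 - a), the generating function of n |-> m_n^{a,c} (x + u) is
    (1 + p z)^(x+u) (1 + a p z)^(-x-c-u) = G_1(z) r_1(z)^u, where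
    r_1 = (1 + p z) / (1 + a p z) is a local coordinate at the point 1.  The one
    of n |-> a^-u m_n^{1/a,c} (x + u) is likewise G_2(z) r_2(z)^u, with r_2 a
    local coordinate at 1/a.  So a row of the Casorati matrix lists a Taylor
    coefficient, at 1 or at 1/a, of the monomials s^0, s^1, ... times a weight
    that depends on x.

    Let K_i = max F_i + 1 and N = K_1 + K_2.  Put all rows n < K_1 and n < K_2
    together into an N x N matrix T; this is a weighted confluent Vandermonde
    matrix, whose determinant does not depend on x (confluent_det).  The
    differential s^l ds / ((s - 1)^K_1 (s - 1/a)^K_2) has residues at 1 and
    1/a that add up to minus its residue at infinity, which is 0 for
    l < N - 1 and -1 for l = N - 1 (residueE).  Computed in the coordinates r_1
    and r_2, the residue at a node pairs the n-th Taylor coefficient of one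
    factor with the (K_i - 1 - n)-th of the other.  The weight left for the
    second factor is the inverse of the first one times (1 + t z)^(N - 2), where
    1 + t z is the denominator of r_i; this is the weight at -x for the
    parameter -c - max F_1 - max F_2.  Hence T is dual to the matrix T' at -x, up to
    reversal of the rows in each block and a triangular Gram matrix
    (meixner_jet_pairing).

    By Jacobi's theorem on complementary minors (complementary_minor), the
    minor of T with rows F_1, F_2 and the first k columns is then proportional
    to the minor of T' whose rows are the reversed complements, that is the
    rows I(F_1), I(F_2), with the first N - k columns.  What remains is the
    constant: signs come from sorting the rows (rowdet_shuffle), powers of a and
    1 - a from det T and the residues (dual_const). *)

(** * Determinants given by a list of rows *)

Section RowDeterminants.
Variable R : comNzRingType.
Implicit Types (r s : seq (nat -> R)) (x y : nat -> R).

(** A row is a sequence of unbounded length that the determinant truncates to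
    the number of rows, so that the same rows can be used for minors of
    different sizes. *)
Definition rowdet r : R :=
  \det (\matrix_(i < size r, j < size r) nth (fun=> 0) r i j).

Lemma rowdetE n r : size r = n ->
  rowdet r = \det (\matrix_(i < n, j < n) nth (fun=> 0) r i j).
Proof. by move=> <-. Qed.

Lemma eq_rowdet (T : eqType) (s : seq T) (f g : T -> nat -> R) :
    {in s, forall t, f t =1 g t} ->
  rowdet (map f s) = rowdet (map g s).
Proof.
case: s => [|t0 s] fg; first by [].
rewrite !(rowdetE (size_map _ _)); congr (\det _); apply/matrixP=> i j.
by rewrite !mxE !(nth_map t0) ?fg ?mem_nth.
Qed.

Lemma rowdet_scale (T : eqType) (s : seq T) (d : T -> R) (f : T -> nat -> R) :
  rowdet [seq (fun u => d t * f t u) | t <- s] =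
  (\prod_(t <- s) d t) * rowdet (map f s).
Proof.
case: s => [|t0 s]; first by rewrite big_nil mul1r.
rewrite !(rowdetE (size_map _ _)) (big_nth t0) big_mkord.
rewrite (_ : \prod_(i < _) _ =
  \det (diag_mx (\row_(i < size (t0 :: s)) d (nth t0 (t0 :: s) i)))); last first.
  by rewrite det_diag; apply: eq_bigr => i _; rewrite mxE.
rewrite -det_mulmx; congr (\det _); apply/matrixP=> i j.
by rewrite mul_diag_mx !mxE !(nth_map t0).
Qed.

Lemma rowdet_swap s1 x y s2 :
  rowdet (s1 ++ x :: y :: s2) = - rowdet (s1 ++ y :: x :: s2).
Proof.
set r := s1 ++ _; set r' := s1 ++ _.
have szr : size r = size r' by rewrite /r /r' !size_cat.
rewrite (rowdetE szr) /rowdet.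
have lt1 : (size s1 < size r')%N by rewrite /r' size_cat /=; lia.
have lt2 : ((size s1).+1 < size r')%N by rewrite /r' size_cat /=; lia.
set i1 := Ordinal lt1; set i2 := Ordinal lt2.
have i12 : i1 != i2 by rewrite -val_eqE /=; lia.
set A := (X in - \det X).
rewrite (_ : \matrix_(i, j) _ = xrow i1 i2 A); last first.
  apply/matrixP=> i j; rewrite !mxE.
  case: tpermP => [->|->|/eqP ne1 /eqP ne2] /=.
  - by rewrite /r /r' !nth_cat ltnn ltnNge leqnSn /= subnn subSnn.
  - by rewrite /r /r' !nth_cat ltnn ltnNge leqnSn /= subnn subSnn.
  rewrite /r /r' !nth_cat; case: ltnP => // le.
  have {}ne1 : nat_of_ord i <> size s1 by move=> e; case/eqP: ne1; apply: val_inj.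
  have {}ne2 : nat_of_ord i <> (size s1).+1.
    by move=> e; case/eqP: ne2; apply: val_inj.
  have -> : (i - size s1 = (i - size s1 - 2).+2)%N.
    by move: (nat_of_ord i) (size s1) ne1 ne2 le => k l; lia.
  by [].
by rewrite xrowE det_mulmx det_perm odd_tperm i12 expr1 mulN1r.
Qed.

Lemma rowdet_move s1 x s s2 :
  rowdet (s1 ++ x :: s ++ s2) = (-1) ^+ size s * rowdet (s1 ++ s ++ x :: s2).
Proof.
elim: s s1 => [|y s IH] s1 /=; first by rewrite mul1r.
by rewrite rowdet_swap -cat_rcons IH cat_rcons exprS mulN1r mulNr.
Qed.

Lemma rowdet_move_block s1 r s s2 :
  rowdet (s1 ++ r ++ s ++ s2) =
  (-1) ^+ (size r * size s) * rowdet (s1 ++ s ++ r ++ s2).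
Proof.
elim: r s1 => [|x r IH] s1 /=; first by rewrite mul1r.
by rewrite -cat_rcons IH cat_rcons rowdet_move mulrA -exprD mulSn addnC.
Qed.

(** The complement is listed backwards because the involution on sets reverses
    it.  The sign is found by inserting the indices one at a time: the largest
    one has to cross the reversed complement, whether or not it is selected. *)
Lemma rowdet_shuffle (f : nat -> nat -> R) (P : pred nat) n s1 s2 :
  let A := filter P (iota 0 n) in let B := filter (predC P) (iota 0 n) in
  rowdet (s1 ++ map f A ++ map f (rev B) ++ s2) =
  (-1) ^+ (\sum_(i <- A) i + 'C(size A, 2) + 'C(size B, 2))
    * rowdet (s1 ++ map f (iota 0 n) ++ s2).
Proof.
elim: n s2 => [|n IH] s2; first by rewrite /= big_nil mul1r.
move: IH; rewrite -[n.+1]addn1 iotaD /= add0n => IH; rewrite !filter_cat /=.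
have szAB : (size (filter P (iota 0 n)) + size (filter (predC P) (iota 0 n)))%N
    = n by rewrite !size_filter count_predC size_iota.
move: IH szAB; set A := filter P _; set B := filter (predC P) _ => IH szAB.
case: (P n) => /=.
  rewrite !cats0 !map_cat -!catA /= [LHS](_ : _ =
    (-1) ^+ size B * rowdet (s1 ++ map f A ++ map f (rev B) ++ f n :: s2)).
    rewrite IH mulrA -exprD big_cat big_seq1 size_cat /= addn1 binS bin1.
    rewrite -signr_odd -[in RHS]signr_odd; congr ((-1) ^+ (nat_of_bool _) * _).
    rewrite -szAB !oddD; by do 5 case: (odd _).
  rewrite catA rowdet_move size_map size_rev; congr (_ * rowdet _).
  by rewrite -!catA.
rewrite !cats0 rev_cat /= !map_cat -!catA /= [LHS](_ : _ =
    (-1) ^+ size B * rowdet (s1 ++ map f A ++ map f (rev B) ++ f n :: s2)).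
  rewrite IH mulrA -exprD size_cat /= addn1 binS bin1.
  rewrite -signr_odd -[in RHS]signr_odd; congr ((-1) ^+ (nat_of_bool _) * _).
  rewrite !oddD; by do 5 case: (odd _).
rewrite catA rowdet_move size_map size_rev; congr (_ * rowdet _).
by rewrite -!catA.
Qed.

(** Subtracting b times each column from the next one clears the first row but
    for its first entry. *)
Lemma rowdet_geometric (b : R) x0 r : (forall u, x0 u = b ^+ u) ->
  rowdet (x0 :: r) =
  rowdet [seq (fun u => x u.+1 - b * x u) | x <- r].
Proof.
move=> x0E; set n := size r; rewrite (@rowdetE (1 + n)) // (rowdetE (size_map _ _)).
set A := (X in \det X = _); set A' := (X in _ = \det X).
(* C performs the column operations. *)
pose C : 'M[R]_(1 + n) :=
  \matrix_(i, j) ((i == j)%:R - b * (i.+1 == j)%:R).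
have detC : \det C = 1.
  rewrite -det_tr det_trig; last first.
    apply/is_trig_mxP => i j lt_ij.
    rewrite !mxE (gtn_eqF _) 1?(ltn_eqF _) //.
      by rewrite -val_eqE /= (gtn_eqF lt_ij) mulr0 subr0.
    lia.
  apply: big1 => i _; rewrite !mxE eqxx (gtn_eqF (ltnSn i)).
  by rewrite mulr0 subr0.
have E : A *m C = block_mx 1%:M 0 (dlsubmx A) A'.
  apply/matrixP=> i j; rewrite mxE.
  have -> : \sum_k A i k * C k j =
     nth (fun=> 0) (x0 :: r) i j -
     (if j == 0%N :> nat then 0 else b * nth (fun=> 0) (x0 :: r) i j.-1).
    under eq_bigr => k _ do rewrite !mxE mulrBr.
    rewrite sumrB; congr (_ - _).
      rewrite (bigD1 j) //= eqxx mulr1 big1 ?addr0 // => k /negPf ->.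
      by rewrite mulr0.
    case: j => [[|j] ltj] /=.
      by apply: big1 => k _; rewrite !mulr0.
    rewrite (bigD1 (Ordinal (ltnW ltj))) //= eqxx mulr1 big1 ?addr0.
      by rewrite mulrC.
    move=> k; rewrite -val_eqE /= => /negPf ne; rewrite eqSS ne !mulr0 //.
  case: (split_ordP i) => i' ->; case: (split_ordP j) => j' ->;
    rewrite ?block_mxEul ?block_mxEur ?block_mxEdl ?block_mxEdr !mxE /=.
  - by rewrite !ord1 /= x0E subr0.
  - by rewrite !ord1 /= !x0E -exprS subrr.
  - by rewrite !ord1 /= subr0.
  - by rewrite (nth_map (fun=> 0)).
by rewrite -[LHS]mulr1 -detC -det_mulmx E det_lblock det1 mul1r.
Qed.

Lemma det_antitriangular n (H : 'M[R]_n) :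
    (forall i j : 'I_n, (i + j < n.-1)%N -> H i j = 0) ->
    (forall i j : 'I_n, (i + j = n.-1)%N -> H i j = 1) ->
  \det H = (-1) ^+ 'C(n, 2).
Proof.
elim: n H => [|n IH] H H0 H1; first by rewrite det_mx00.
rewrite (expand_det_row _ ord0) (bigD1 ord_max) //= big1 ?addr0.
  rewrite H1 // mul1r /cofactor IH.
  - by rewrite -exprD /= add0n binS bin1 addnC.
  - move=> i j lt; rewrite !mxE; apply: H0; rewrite lift0 lift_max; lia.
  - move=> i j eq; rewrite !mxE; apply: H1; rewrite lift0 lift_max; have := ltn_ord i; lia.
move=> j; rewrite -val_eqE /= => ne; rewrite H0 ?mul0r // add0n.
by have := ltn_ord j; lia.
Qed.

(** Jacobi's complementary minor theorem, in a form that avoids inverses: let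
    T be the matrix of g on the rows s ++ t, let Z1 and Z be those of z on s and
    on t with the first |t| columns, and let A be the minor of g on s.  The
    pairing hypothesis makes T^T * [[1, Z1], [0, Z]] equal to
    [[A^T, 0], [*, H]] with H antitriangular, and it is enough to compare the
    determinants. *)
Lemma complementary_minor (T : eqType) (s t : seq T) (g z : T -> nat -> R) :
    let n := (size s + size t)%N in
    (forall u v, (u + v < n)%N ->
       \sum_(x <- s ++ t) g x u * z x v = ((u + v).+1 == n)%N%:R) ->
  rowdet (map g (s ++ t)) * rowdet (map z t) =
  (-1) ^+ 'C(size t, 2) * rowdet (map g s).
Proof.
move=> n pairing.
case: (posnP n) => [n0|n_gt0].
  have s0 : s = [::] by apply/nilP; rewrite /nilp; lia.
  have t0 : t = [::] by apply/nilP; rewrite /nilp; lia.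
  by rewrite s0 t0 /= /rowdet !det_mx00 !mulr1.
have [x0 _] : exists x : T, True.
  move: n_gt0; rewrite /n.
  by case: {n pairing} s => [|x s]; [case: t => [|y t] //; exists y | exists x].
set k := size s in n pairing n_gt0 *; set m := size t in n pairing n_gt0 *.
have gE (r : seq T) (f : T -> nat -> R) : rowdet (map f r) =
   \det (\matrix_(i < size r, j < size r) f (nth x0 r i) j).
  rewrite (rowdetE (size_map _ _)); congr (\det _); apply/matrixP => i j.
  by rewrite !mxE (nth_map x0).
have -> : rowdet (map g (s ++ t)) =
   \det (\matrix_(i < k + m, j < k + m) g (nth x0 (s ++ t) i) j).
  rewrite (@rowdetE (k + m)) ?size_map ?size_cat //.
  congr (\det _); apply/matrixP => i j.
  by rewrite !mxE (nth_map x0) // size_cat.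
rewrite !gE -/m -/k.
set A := \matrix_(i < k, j < k) _; set Z := \matrix_(i < m, j < m) _.
set T' := \matrix_(i < k + m, j < k + m) _.
pose Z1 := \matrix_(i < k, j < m) z (nth x0 s i) j.
pose H := \matrix_(i < m, j < m)
  \sum_(x <- s ++ t) g x (k + i)%N * z x j.
have detH : \det H = (-1) ^+ 'C(m, 2).
  apply: det_antitriangular => i j ij; rewrite mxE pairing.
  - by rewrite [in LHS](_ : (_ == _) = false) //; apply/eqP; rewrite /n; lia.
  - rewrite /n; lia.
  - by rewrite [in LHS](_ : (_ == _) = true) //; apply/eqP; rewrite /n; have := ltn_ord i; lia.
  - by rewrite /n; have := ltn_ord i; lia.
have sumE u (v : 'I_m) :
   \sum_i T' i u * col_mx Z1 Z i v = \sum_(x <- s ++ t) g x u * z x v.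
  rewrite [RHS](big_nth x0) size_cat big_mkord; apply: eq_bigr => i _.
  rewrite mxE; congr (_ * _).
  case: (split_ordP i) => i' ->; rewrite ?col_mxEu ?col_mxEd mxE nth_cat /=.
    by rewrite ltn_ord.
  by rewrite ltnNge leq_addr /= addKn.
have E : T'^T *m block_mx 1%:M Z1 0 Z = block_mx A^T 0 (ursubmx T')^T H.
  apply/matrixP => i j; case: (split_ordP j) => j' ->; last first.
    rewrite mxE.
    have -> : \sum_k0 T'^T i k0 * block_mx 1%:M Z1 0 Z k0 (rshift k j') =
       \sum_(x <- s ++ t) g x i * z x j'.
      rewrite -sumE; apply: eq_bigr => l _; rewrite [T'^T _ _]mxE; congr (_ * _).
      by case: (split_ordP l) => l' ->;
        rewrite ?block_mxEur ?block_mxEdr ?col_mxEu ?col_mxEd.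
    case: (split_ordP i) => i' ->; rewrite ?block_mxEur ?block_mxEdr.
      rewrite pairing; last by rewrite /n /=; have := ltn_ord i'; have := ltn_ord j'; lia.
      rewrite mxE (_ : (_ == n) = false) //; apply/eqP.
      by rewrite /n /=; have := ltn_ord i'; have := ltn_ord j'; lia.
    by rewrite [H _ _]mxE.
  rewrite mxE (bigD1 (lshift m j')) //= block_mxEul [1%:M _ _]mxE eqxx mulr1 big1 ?addr0.
    case: (split_ordP i) => i' ->; rewrite ?block_mxEul ?block_mxEdl !mxE.
      by rewrite nth_cat /= ltn_ord.
    by rewrite nth_cat /= ltn_ord.
  move=> l; case: (split_ordP l) => l' ->; rewrite ?block_mxEul ?block_mxEdl.
    by rewrite (inj_eq (@lshift_inj _ _)) [1%:M _ _]mxE => /negPf ->; rewrite mulr0.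
  by rewrite [X in _ * X]mxE mulr0.
have := congr1 (@determinant _ _) E.
rewrite det_mulmx det_tr det_ublock det1 mul1r det_lblock det_tr detH => ->.
by rewrite mulrC.
Qed.

End RowDeterminants.

(** * Cauchy products and binomial series *)

Section CauchyProduct.
Variable R : comNzRingType.
Implicit Types u v w : nat -> R.

Definition conv u v (n : nat) : R := \sum_(j < n.+1) u j * v (n - j)%N.

(** Truncating to polynomials transfers the commutative ring laws to Cauchy
    products. *)
Lemma conv_coefM u v (N n : nat) : (n < N)%N ->
  conv u v n = ((\poly_(i < N) u i) * (\poly_(i < N) v i))`_n.
Proof.
move=> ltnN; rewrite coefM; apply: eq_bigr => j _; rewrite !coef_poly.
have -> : (j < N)%N by have := ltn_ord j; lia.
by have -> : (n - j < N)%N by lia.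
Qed.

Lemma eq_conv u u' v v' : u =1 u' -> v =1 v' -> conv u v =1 conv u' v'.
Proof. by move=> uu' vv' n; apply: eq_bigr => j _; rewrite uu' vv'. Qed.

Lemma convC u v : conv u v =1 conv v u.
Proof. by move=> n; rewrite !(conv_coefM _ _ (ltnSn n)) mulrC. Qed.

Lemma convA u v w : conv u (conv v w) =1 conv (conv u v) w.
Proof.
move=> n; pose t f := \poly_(i < n.+1) f i : {poly R}.
have tE f g m : (m <= n)%N -> conv f g m = (t f * t g)`_m.
  by move=> lemn; apply: conv_coefM.
transitivity (t u * (t v * t w))`_n.
  rewrite coefM; apply: eq_bigr => j _; rewrite coef_poly ltn_ord.
  by rewrite tE ?leq_subr.
rewrite mulrA coefM; apply: eq_bigr => j _; rewrite coef_poly.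
by rewrite ltnS leq_subr tE // -ltnS.
Qed.

Lemma conv_interchange u v u' v' :
  conv (conv u v) (conv u' v') =1 conv (conv u u') (conv v v').
Proof.
move=> n; rewrite -convA -[RHS]convA; apply: eq_conv => // {}n.
by rewrite convA convA; apply: eq_conv => // {}n; rewrite convC.
Qed.

(** Multiplication by 1 + s z commutes with the Cauchy product. *)
Lemma conv_recl u v w s n :
    w 0%N = u 0%N -> (forall j, w j.+1 = u j.+1 + s * u j) ->
  conv w v n.+1 = conv u v n.+1 + s * conv u v n.
Proof.
move=> w0 wS; rewrite /conv big_ord_recl [in RHS]big_ord_recl w0 -addrA.
congr (_ + _); rewrite mulr_sumr -big_split; apply: eq_bigr => j _ /=.
by rewrite /bump /= add1n subSS wS mulrDl mulrA.
Qed.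

End CauchyProduct.

Section Binomial.
Variable K : fieldType.
Hypothesis char0 : [pchar K] =i pred0.
Implicit Types (p q y w s t b : {poly K}) (n j u : nat).

Lemma natr_poly_neq0 n : n.+1%:R != 0 :> {poly K}.
Proof. by rewrite -polyC_natr polyC_eq0 (proj1 (pcharf0P _) char0). Qed.

Lemma pbinom0 p : pbinom p 0 = 1.
Proof. by rewrite /pbinom big_ord0 invr1 scale1r. Qed.

Lemma pbinomS p n : n.+1%:R * pbinom p n.+1 = (p - n%:R) * pbinom p n.
Proof.
have n0 := proj1 (pcharf0P _) char0 n.+1.
rewrite /pbinom big_ord_recr /= -[n.+1%:R]polyC_natr mul_polyC scalerA.
rewrite factS natrM invfM mulrA divff ?n0 // mul1r -scalerAr.
by congr (_ *: _); rewrite mulrC.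
Qed.

Lemma pbinom_pascal p n :
  pbinom (p + 1) n.+1 = pbinom p n.+1 + pbinom p n.
Proof.
elim: n => [|n IH].
  by apply: (mulfI (natr_poly_neq0 0)); rewrite mulrDr !pbinomS !pbinom0; ring.
apply: (mulfI (natr_poly_neq0 n.+1)); rewrite mulrDr !pbinomS IH.
have := pbinomS p n; move: (pbinom p n.+1) (pbinom p n) => B b' E.
have -> : (p + 1 - n.+1%:R) * (B + b') = (p - n%:R) * B + (p - n%:R) * b'.
  by ring.
by rewrite -E; ring.
Qed.

Lemma pbinom_comp p q n : pbinom p n \Po q = pbinom (p \Po q) n.
Proof.
rewrite /pbinom comp_polyZ rmorph_prod; congr (_ *: _).
by apply: eq_bigr => i _; rewrite /= comp_polyB -polyC_natr comp_polyC.
Qed.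

Lemma pbinom_small m n : (m < n)%N -> pbinom (m%:R : {poly K}) n = 0.
Proof.
by move=> lt; rewrite /pbinom (bigD1 (Ordinal lt)) //= subrr mul0r scaler0.
Qed.

(** The Taylor coefficients in z of (1 + s z)^y. *)
Definition bseries s y n : {poly K} := s ^+ n * pbinom y n.

(** The Chu-Vandermonde identity: both sides satisfy the recurrence pbinomS, as
    one sees by splitting the factor n + 1 into j + (n + 1 - j) inside the sum. *)
Lemma bseriesD s y w : conv (bseries s y) (bseries s w) =1 bseries s (y + w).
Proof.
have E n : conv (bseries s y) (bseries s w) n =
    s ^+ n * conv (pbinom y) (pbinom w) n.
  rewrite mulr_sumr; apply: eq_bigr => j _; rewrite /bseries mulrACA -exprD.
  by rewrite subnKC // -ltnS.
move=> n; rewrite E /bseries; congr (_ * _).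
elim: n => [|n IH]; first by rewrite /conv big_ord1 !pbinom0 mulr1.
apply: (mulfI (natr_poly_neq0 n)); rewrite pbinomS -IH.
have -> : n.+1%:R * conv (pbinom y) (pbinom w) n.+1 =
    \sum_(j < n.+2) j%:R * pbinom y j * pbinom w (n.+1 - j) +
    \sum_(j < n.+2) pbinom y j * ((n.+1 - j)%N%:R * pbinom w (n.+1 - j)).
  rewrite mulr_sumr -big_split; apply: eq_bigr => j _ /=.
  have -> : n.+1%:R = j%:R + (n.+1 - j)%N%:R :> {poly K}.
    by rewrite -natrD subnKC // -ltnS.
  by ring.
rewrite big_ord_recl !mul0r add0r [X in _ + X]big_ord_recr /=.
rewrite subnn mul0r mulr0 addr0 -big_split mulr_sumr; apply: eq_bigr => j _ /=.
rewrite /bump /= add1n subSS pbinomS subSn -1?ltnS // pbinomS natrB -1?ltnS //.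
by ring.
Qed.

(** The Taylor coefficients in z of (1 + s z)^y (1 + t z)^w. *)
Definition gseries s t y w : nat -> {poly K} := conv (bseries s y) (bseries t w).

Lemma gseries0 s t y w : gseries s t y w 0 = 1.
Proof. by rewrite /gseries /conv big_ord1 /bseries !pbinom0 !mulr1. Qed.

Lemma gseriesD s t y w y' w' :
  conv (gseries s t y w) (gseries s t y' w') =1 gseries s t (y + y') (w + w').
Proof.
by move=> n; rewrite conv_interchange; apply: eq_conv => m; apply: bseriesD.
Qed.

Lemma bseries_shift s y n :
  bseries s (y + 1) n.+1 = bseries s y n.+1 + s * bseries s y n.
Proof. by rewrite /bseries pbinom_pascal exprS; ring. Qed.

Lemma gseries_shiftl s t y w n :
  gseries s t (y + 1) w n.+1 = gseries s t y w n.+1 + s * gseries s t y w n.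
Proof.
apply: conv_recl => [|j]; first by rewrite /bseries !pbinom0.
exact: bseries_shift.
Qed.

Lemma gseries_shiftr s t y w n :
  gseries s t y (w + 1) n.+1 = gseries s t y w n.+1 + t * gseries s t y w n.
Proof.
rewrite /gseries !(convC (bseries s y)).
by apply: conv_recl => [|j]; [rewrite /bseries !pbinom0 | apply: bseries_shift].
Qed.

(** Here r = b (1 + s z) / (1 + t z) is, when s - t = 1, a local coordinate at
    the node b, and jet is the n-th Taylor coefficient in z of r^u times the
    weight (1 + s z)^y (1 + t z)^w. *)
Definition jet b s t y w n u : {poly K} :=
  b ^+ u * gseries s t (y + u%:R) (w - u%:R) n.

Lemma jet0 b s t y w u : jet b s t y w 0 u = b ^+ u.
Proof. by rewrite /jet gseries0 mulr1. Qed.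

Section Node.
Variables b s t : {poly K}.
Hypothesis stE : s - t = 1.

(** Indeed r - b = b z / (1 + t z). *)
Lemma jet_own_node y w n u :
  jet b s t y w n.+1 u.+1 - b * jet b s t y w n.+1 u = b * jet b s t y (w - 1) n u.
Proof.
rewrite /jet -[u.+1%:R]natr1 addrA.
have -> : w - (u%:R + 1) = w - 1 - u%:R by ring.
have -> : w - u%:R = (w - 1 - u%:R) + 1 by ring.
rewrite gseries_shiftl gseries_shiftr exprS.
have -> : s = t + 1 by rewrite -stE; ring.
by ring.
Qed.

(** The second node b' = b s / t is the value of r at infinity, and
    r - b' = k / (1 + t z): no factor z appears, so the order n stays the
    same. *)
Lemma jet_other_node b' k y w n u : t != 0 -> b' * t = b * s -> k * t = - b ->
  jet b s t y w n u.+1 - b' * jet b s t y w n u = k * jet b s t y (w - 1) n u.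
Proof.
move=> t0 b'E kE.
have kb' : k = b - b'.
  by apply: (mulIf t0); rewrite kE mulrBl b'E -[in LHS](mulr1 b) -stE; ring.
case: n => [|n]; first by rewrite !jet0 exprS kb'; ring.
rewrite /jet -[u.+1%:R]natr1 addrA.
have -> : w - (u%:R + 1) = w - 1 - u%:R by ring.
have -> : w - u%:R = (w - 1 - u%:R) + 1 by ring.
rewrite gseries_shiftl gseries_shiftr exprS kb'.
move: (gseries _ _ _ _ n.+1) (gseries _ _ _ _ n) => A B.
have -> : b * b ^+ u * (A + s * B) - b' * (b ^+ u * (A + t * B)) =
  b ^+ u * ((b - b') * A + (b * s - b' * t) * B) by ring.
by rewrite b'E; ring.
Qed.

(** The Taylor coefficients of a product of two weighted powers of r. *)
Lemma jet_pairing y w y' w' n u v :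
  \sum_(i < n.+1) jet b s t y w i u * jet b s t y' w' (n - i) v =
  jet b s t (y + y') (w + w') n (u + v).
Proof.
have -> : jet b s t (y + y') (w + w') n (u + v) = b ^+ (u + v) *
   gseries s t ((y + u%:R) + (y' + v%:R)) ((w - u%:R) + (w' - v%:R)) n.
  by rewrite /jet natrD; congr (_ * gseries _ _ _ _ _); ring.
rewrite -gseriesD mulr_sumr; apply: eq_bigr => i _.
by rewrite /jet exprD; ring.
Qed.

End Node.
End Binomial.

(** * The two nodes 1 and 1/a *)

(** The tag true stands for the node 1 and the tag false for 1/a. *)
Definition tagged_rows (s1 s2 : seq nat) : seq (bool * nat) :=
  [seq (true, n) | n <- s1] ++ [seq (false, n) | n <- s2].

Section TwoNodes.
Variables (K : fieldType) (a : K).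
Hypotheses (char0 : [pchar K] =i pred0) (a_neq0 : a != 0) (a_neq1 : a != 1).
Implicit Types (y w : {poly K}).

Let p := (1 - a)^-1.

Let q_neq0 : 1 - a != 0. Proof. by rewrite subr_eq0 eq_sym. Qed.
Let qp : (1 - a) * p = 1. Proof. by rewrite mulfV. Qed.
Let p_neq0 : p != 0. Proof. by rewrite invr_eq0. Qed.

Definition meixner_jet y w (x : bool * nat) : nat -> {poly K} :=
  if x.1 then jet 1 p%:P (a * p)%:P y w x.2
  else jet (a^-1)%:P (- (a * p))%:P (- p)%:P y w x.2.

Let stE1 : p%:P - (a * p)%:P = 1 :> {poly K}.
Proof. by rewrite -polyCB -[X in X - _]mul1r -mulrBl qp. Qed.

Let stE2 : (- (a * p))%:P - (- p)%:P = 1 :> {poly K}.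
Proof. by rewrite -stE1 !polyCN; ring. Qed.

Let rho := (1 - a) / a.

(** The next four lemmas express multiplication by s - 1 and by s - 1/a on the
    Taylor coefficients at 1 and at 1/a; the weight is only divided by
    1 + t z, hence the shift from w to w - 1. *)
Lemma jet1_own y w n u :
  meixner_jet y w (true, n.+1) u.+1 - meixner_jet y w (true, n.+1) u =
  meixner_jet y (w - 1) (true, n) u.
Proof. by have := jet_own_node char0 1 stE1 y w n u; rewrite !mul1r. Qed.

Lemma jet2_own y w n u :
  meixner_jet y w (false, n.+1) u.+1
    - (a^-1)%:P * meixner_jet y w (false, n.+1) u =
  (a^-1)%:P * meixner_jet y (w - 1) (false, n) u.
Proof. exact: (jet_own_node char0). Qed.

Lemma jet1_other y w n u :
  meixner_jet y w (true, n) u.+1 - (a^-1)%:P * meixner_jet y w (true, n) u =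
  (- rho)%:P * meixner_jet y (w - 1) (true, n) u.
Proof.
apply: (jet_other_node char0 stE1).
- by rewrite polyC_eq0 mulf_neq0.
- by rewrite -polyCM mulKf // mul1r.
- rewrite -polyCM -polyCN; congr _%:P; rewrite /rho mulNr.
  by rewrite mulrA divfK // qp.
Qed.

Lemma jet2_other y w n u :
  meixner_jet y w (false, n) u.+1 - meixner_jet y w (false, n) u =
  rho%:P * meixner_jet y (w - 1) (false, n) u.
Proof.
rewrite -[X in _ - X]mul1r; apply: (jet_other_node char0 stE2).
- by rewrite polyC_eq0 oppr_eq0.
- by rewrite mul1r -polyCM mulrN mulKf.
- rewrite -polyCM -polyCN; congr _%:P; rewrite /rho mulrN.
  by rewrite mulrAC qp mul1r.
Qed.

Lemma prodr_const_list (s : seq nat) (c : {poly K}) : \prod_(i <- s) c = c ^+ size s.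
Proof. by rewrite big_const_seq count_predT iter_mulr_1. Qed.

(** The first row is geometric in u; eliminating it amounts to multiplying all
    polynomials by s minus the node, which lowers the order at that node by one,
    scales the rows of the other node by the distance of the nodes, and those of
    the same node by the derivative of its local coordinate (1 at the node 1,
    1/a at 1/a). *)
Lemma confluent_det K1 K2 y w :
  rowdet (map (meixner_jet y w) (tagged_rows (iota 0 K1) (iota 0 K2))) =
  (rho ^+ (K1 * K2) * a^-1 ^+ 'C(K2, 2))%:P.
Proof.
have iotaS n : iota 1 n = map S (iota 0 n) by apply: (iotaDl 1 0 n).
elim: K1 w => [|K1 IH] w.
  rewrite mul0n expr0 mul1r; elim: K2 w => [|K2 IH] w.
    by rewrite /rowdet det_mx00.
  rewrite /tagged_rows /= (rowdet_geometric (b := (a^-1)%:P)); last first.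
    exact: jet0.
  rewrite iotaS -!map_comp.
  rewrite (eq_rowdet
    (g := fun n u => (a^-1)%:P * meixner_jet y (w - 1) (false, n) u)); last first.
    by move=> n _ u; apply: jet2_own.
  rewrite (rowdet_scale _ (fun=> (a^-1)%:P)) prodr_const_list size_iota.
  have := IH (w - 1); rewrite /tagged_rows /= -map_comp => ->.
  by rewrite -polyC_exp -polyCM -exprD binS bin1 addnC.
rewrite /tagged_rows /= (rowdet_geometric (b := 1)); last exact: jet0.
pose d (x : bool * nat) : {poly K} := if x.1 then 1 else rho%:P.
transitivity (rowdet [seq (fun u => d x * meixner_jet y (w - 1) x u) |
    x <- tagged_rows (iota 0 K1) (iota 0 K2)]).
  pose h x u := if x.1 then meixner_jet y w (true, x.2.+1) u.+1 -
      1 * meixner_jet y w (true, x.2.+1) u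
    else meixner_jet y w (false, x.2) u.+1 - 1 * meixner_jet y w (false, x.2) u.
  rewrite -(eq_rowdet (f := h)).
    by rewrite iotaS /tagged_rows !map_cat -!map_comp.
  move=> [[] n] _ u; rewrite /h /d /= !mul1r; first exact: jet1_own.
  exact: jet2_other.
rewrite rowdet_scale IH big_cat !big_map !prodr_const_list !size_iota expr1n /= mul1r.
by rewrite -polyC_exp -polyCM mulrA -exprD mulSn.
Qed.

(** alpha and beta are the constants left at the nodes 1 and 1/a when
    ds / ((s - 1)^K1 (s - 1/a)^K2) is written in the local coordinate z; the
    rest is z^-Ki times a power of 1 + t z, which joins the weight. *)
Definition alpha K2 : K := (- rho^-1) ^+ K2.
Definition beta K1 K2 : K := a^-1 * a ^+ (K1 + K2) * p ^+ K1.

(** The residue at a pole of order n needs the Taylor coefficient of order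
    n - 1; there is no residue when n is 0. *)
Definition top_jet w (b : bool) (n l : nat) : {poly K} :=
  if n is m.+1 then meixner_jet 0 w (b, m) l else 0.

(** The sum of the residues at 1 and 1/a of s^l / ((s - 1)^K1 (s - 1/a)^K2).
    The term -2 in the weight comes from the derivatives of the local
    coordinates. *)
Let residue K1 K2 l : {poly K} :=
  let w := (K1 + K2)%:R - 2%:R in
  (alpha K2)%:P * top_jet w true K1 l + (beta K1 K2)%:P * top_jet w false K2 l.

Let rho_neq0 : rho != 0.
Proof. by rewrite mulf_neq0 ?invr_eq0. Qed.

Let top_own1 w K1 l :
  top_jet w true K1.+1 l.+1 - top_jet w true K1.+1 l = top_jet (w - 1) true K1 l.
Proof.
case: K1 => [|K1]; last exact: jet1_own.
by rewrite /top_jet /meixner_jet /= !jet0 !expr1n subrr.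
Qed.

Let top_own2 w K2 l :
  top_jet w false K2.+1 l.+1 - (a^-1)%:P * top_jet w false K2.+1 l =
  (a^-1)%:P * top_jet (w - 1) false K2 l.
Proof.
case: K2 => [|K2]; last exact: jet2_own.
by rewrite /top_jet /meixner_jet /= !jet0 -exprS subrr mulr0.
Qed.

Let residue_own1 K1 K2 l :
  residue K1.+1 K2 l.+1 - residue K1.+1 K2 l = residue K1 K2 l.
Proof.
have w1 : (K1.+1 + K2)%:R - 2%:R - 1 = (K1 + K2)%:R - 2%:R :> {poly K}.
  by rewrite addSn -natr1; ring.
have o2 w : top_jet w false K2 l.+1 - top_jet w false K2 l =
    rho%:P * top_jet (w - 1) false K2 l.
  by case: K2 {w1} => [|K2]; [rewrite /= subrr mulr0 | apply: jet2_other].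
have b2 : (beta K1.+1 K2)%:P * rho%:P = (beta K1 K2)%:P.
  rewrite -polyCM /beta /rho addSn; congr _%:P; rewrite !exprS.
  rewrite [LHS](_ : _ = a^-1 * a ^+ (K1 + K2) * p ^+ K1 * (a / a) * ((1 - a) * p)).
    by rewrite qp divff // !mulr1.
  by ring.
rewrite /residue -w1 -top_own1 -b2 -mulrA -o2; set w := _ - 2%:R; ring.
Qed.

Let residue_own2 K1 K2 l :
  residue K1 K2.+1 l.+1 - (a^-1)%:P * residue K1 K2.+1 l = residue K1 K2 l.
Proof.
have w1 : (K1 + K2.+1)%:R - 2%:R - 1 = (K1 + K2)%:R - 2%:R :> {poly K}.
  by rewrite addnS -natr1; ring.
have o1 w : top_jet w true K1 l.+1 - (a^-1)%:P * top_jet w true K1 l =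
    (- rho)%:P * top_jet (w - 1) true K1 l.
  by case: K1 {w1} => [|K1]; [rewrite /= mulr0 subrr mulr0 | apply: jet1_other].
have b1 : (alpha K2.+1)%:P * (- rho)%:P = (alpha K2)%:P.
  by rewrite -polyCM /alpha exprSr -mulrA mulrNN mulVf // mulr1.
have b2 : (beta K1 K2.+1)%:P * (a^-1)%:P = (beta K1 K2)%:P.
  rewrite -polyCM /beta addnS exprS; congr _%:P.
  rewrite [LHS](_ : _ = a^-1 * a ^+ (K1 + K2) * p ^+ K1 * (a / a)).
    by rewrite divff // mulr1.
  by ring.
rewrite /residue -w1 -b1 -b2 -!mulrA -top_own2 -o1; set w := _ - 2%:R; ring.
Qed.

Let residue0 K1 K2 : (0 < K1 + K2)%N -> residue K1 K2 0 = (1 == K1 + K2)%N%:R.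
Proof.
have small b n : (0 < n)%N -> top_jet (n%:R - 2%:R) b n 0 = (1 == n)%N%:R.
  case: n => [|[|n]] // _; rewrite /top_jet /meixner_jet /=.
    by case: b; rewrite jet0.
  (* At u = 0 the weight is a polynomial of degree n, and the coefficient of
     order n + 1 is asked for. *)
  have E s t c : jet c s t (0 : {poly K}) (n.+2%:R - 2%:R) n.+1 0 = 0.
    rewrite /jet mul1r subr0 addr0 /gseries /conv big_ord_recl /= big1.
      rewrite addr0 /bseries subn0 (_ : n.+2%:R - 2%:R = n%:R).
        by rewrite pbinom_small // !mulr0.
      by rewrite -[n.+2]addn2 natrD addrK.
    by move=> i _; rewrite /bseries /bump add1n (@pbinom_small _ 0) // !(mulr0, mul0r).
  by case: b; rewrite E.
have [n] := ubnP (K1 + K2); elim: n K1 K2 => // n IH [|K1] [|K2] // lt _.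
- rewrite /residue /beta !add0n mulr0 add0r small // mulr1.
  case: K2 {lt} => [|K2]; last by rewrite mulr0.
  by rewrite expr1 mulVf // mulr1.
- by rewrite /residue /alpha mulr0 addr0 expr0 mul1r !addn0 small.
(* Partial fractions: 1 - 1/a is the difference of s - 1/a and s - 1, so either
   pole order can be lowered. *)
have neq : (1 - a^-1 : K)%:P != 0.
  by rewrite polyC_eq0 subr_eq0 -invr1 (inj_eq (@invr_inj _)) eq_sym.
apply: (mulfI neq).
transitivity (residue K1.+1 K2 0 - residue K1 K2.+1 0).
  by rewrite -(residue_own1 K1 K2.+1) -(residue_own2 K1.+1 K2) polyCB; ring.
rewrite !IH; try lia.
by rewrite !addSn !addnS subrr mulr0.
Qed.

(** The residue theorem on the projective line, by induction on l, from
    s^(l+1) = s^l (s - b) + b s^l for a node b of positive order. *)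
Lemma residueE K1 K2 l : (l < K1 + K2)%N ->
  residue K1 K2 l = (l.+1 == K1 + K2)%N%:R.
Proof.
elim: l K1 K2 => [|l IH] K1 K2 lt; first exact: residue0.
case: K1 lt => [|K1] lt.
  case: K2 lt => [|K2] // lt.
  have := residue_own2 0 K2 l => /eqP; rewrite subr_eq => /eqP ->.
  rewrite IH // IH; last by rewrite add0n in lt *; apply: ltnW.
  rewrite add0n in lt *; rewrite (_ : (l.+1 == K2.+1) = false).
    by rewrite mulr0 addr0 eqSS.
  by apply/eqP; lia.
have := residue_own1 K1 K2 l => /eqP; rewrite subr_eq => /eqP ->.
rewrite IH // IH; last by apply: ltnW.
rewrite (_ : (l.+1 == K1.+1 + K2)%N = false) ?addr0 ?addSn ?eqSS //.
by apply/eqP; lia.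
Qed.

Definition dual_coef K1 K2 (x : bool * nat) : {poly K} :=
  if x.1 then (alpha K2)%:P else (beta K1 K2)%:P.

Definition dual_index K1 K2 (x : bool * nat) : bool * nat :=
  if x.1 then (true, K1.-1 - x.2)%N else (false, K2.-1 - x.2)%N.

Lemma meixner_jet_pairing K1 K2 y w w' u v :
    w + w' = (K1 + K2)%:R - 2%:R -> (u + v < K1 + K2)%N ->
  \sum_(x <- tagged_rows (iota 0 K1) (iota 0 K2)) meixner_jet y w x u *
     (dual_coef K1 K2 x * meixner_jet (- y) w' (dual_index K1 K2 x) v) =
  ((u + v).+1 == K1 + K2)%N%:R.
Proof.
move=> ww' lt; rewrite -(residueE lt) /residue -ww' big_cat !big_map /=.
have -> (k1 : nat) : iota 0 k1 = index_iota 0 k1 by rewrite /index_iota subn0.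
have -> (k1 : nat) : iota 0 k1 = index_iota 0 k1 by rewrite /index_iota subn0.
have E b s t n : \sum_(i < n.+1) jet b s t y w i u * jet b s t (- y) w' (n - i) v
   = jet b s t 0 (w + w') n (u + v) by rewrite jet_pairing ?subrr.
rewrite !big_mkord; congr (_ + _).
  case: K1 {lt ww'} => [|K1]; first by rewrite big_ord0 mulr0.
  rewrite /top_jet /meixner_jet /= -E mulr_sumr; apply: eq_bigr => i _.
  exact: mulrCA.
case: K2 {lt ww'} => [|K2]; first by rewrite big_ord0 mulr0.
rewrite /top_jet /meixner_jet /= -E mulr_sumr; apply: eq_bigr => i _.
exact: mulrCA.
Qed.

End TwoNodes.

(** * Duality of minors *)

Lemma bin2D m n : 'C(m + n, 2) = ('C(m, 2) + 'C(n, 2) + m * n)%N.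
Proof.
elim: m => [|m IH]; first by rewrite /= add0n mul0n addn0.
by rewrite addSn !binS !bin1 IH; lia.
Qed.

Definition casorati_norm (K : fieldType) (a : K) (k1 k2 : nat) : K :=
  a ^ ('C(k2, 2)%:Z - k2%:Z * ((k1 + k2)%N%:Z - 1)) * (1 - a) ^+ (k1 * k2).

Lemma casorati_normE (K : fieldType) (a : K) k1 k2 :
  casorati_norm a k1 k2 =
  a ^ (- ('C(k2, 2) + k1 * k2)%N%:Z) * (1 - a) ^+ (k1 * k2).
Proof.
congr (_ ^ _ * _); elim: k2 => [|k2 IH]; first by rewrite muln0 mul0r.
by move: IH; rewrite binS bin1; nia.
Qed.

(** S is the sign exponent of the final identity; the other exponents of -1
    come from the antidiagonal Gram block, from moving one block of rows across
    another and from reversing the complements.  They cancel against the sign of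
    the residues at 1. *)
Lemma dual_const (K : fieldType) (a : K) (k1 k2 m1 m2 S : nat) :
    a != 0 -> 1 - a != 0 ->
  let K1 := (k1 + m1)%N in let K2 := (k2 + m2)%N in
  let rho := (1 - a) / a in
  (-1) ^+ ('C(m1 + m2, 2) + (k2 * m1 + S + 'C(m1, 2) + 'C(m2, 2))) *
    (rho ^+ (K1 * K2) * a^-1 ^+ 'C(K2, 2)) *
    (((- rho^-1) ^+ K2) ^+ m1 * (a^-1 * a ^+ (K1 + K2) * (1 - a)^-1 ^+ K1) ^+ m2)
  = (-1) ^+ S * (casorati_norm a k1 k2 / casorati_norm a m1 m2).
Proof.
move=> a0; set q := 1 - a => q0 K1 K2 rho.
rewrite -exprM [(- _^-1) ^+ _]exprNn !exprMn -!exprM /rho invf_div !exprMn.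
set e := (-1 : K) ^+ _; set e' := (-1 : K) ^+ (K2 * m1).
have -> : forall x y z : K, e * x * (e' * y * z) = e * e' * (x * (y * z)).
  by move=> x y z; ring.
congr (_ * _).
  rewrite /e /e' -exprD -[LHS]signr_odd -[RHS]signr_odd;  congr (_ ^+ nat_of_bool _).
  by rewrite bin2D /K2 !(oddD, oddM); do 8 case: (odd _).
rewrite !casorati_normE -/q invfM.
rewrite !exprVn !exprnP !invr_expz !opprK.
have -> : forall x1 x2 x3 x4 x5 x6 x7 x8 : K,
   x1 * x2 * x3 * (x4 * x5 * (x6 * x7 * x8)) =
   (x2 * x3 * x4 * x6 * x7) * (x1 * x5 * x8) by move=> *; ring.
rewrite [RHS]mulrACA -!expfzDr //; congr (_ * _); congr (_ ^ _).
  have sq : (m2 * m2 = 'C(m2, 2) * 2 + m2)%N.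
    by elim: m2 {K2 e e'} => // n IH; rewrite binS bin1; lia.
  move/(congr1 Posz): sq; rewrite /K1 /K2 !bin2D !(PoszD, PoszM) => sq.
  by rewrite !mulrDl sq; ring.
by rewrite /K1 /K2 !(PoszD, PoszM); ring.
Qed.

Section Core.
Variables (K : fieldType) (a : K).
Hypotheses (char0 : [pchar K] =i pred0) (a_neq0 : a != 0) (a_neq1 : a != 1).

Lemma rowdet_duality (P1 P2 : pred nat) (K1 K2 : nat) (y w w' : {poly K}) :
  let A1 := filter P1 (iota 0 K1) in let B1 := filter (predC P1) (iota 0 K1) in
  let A2 := filter P2 (iota 0 K2) in let B2 := filter (predC P2) (iota 0 K2) in
  w + w' = (K1 + K2)%:R - 2%:R ->
  rowdet (map (meixner_jet a y w) (tagged_rows A1 A2)) =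
  ((-1) ^+ (\sum_(i <- A1) i + 'C(size A1, 2)
            + (\sum_(i <- A2) i + 'C(size A2, 2))) *
    (casorati_norm a (size A1) (size A2) /
     casorati_norm a (size B1) (size B2)))%:P *
  rowdet (map (meixner_jet a (- y) w')
     (tagged_rows [seq (K1.-1 - i)%N | i <- rev B1]
                  [seq (K2.-1 - i)%N | i <- rev B2])).
Proof.
move=> A1 B1 A2 B2 ww'.
have q0 : 1 - a != 0 by rewrite subr_eq0 eq_sym.
have szK1 : K1 = (size A1 + size B1)%N by rewrite !size_filter count_predC size_iota.
have szK2 : K2 = (size A2 + size B2)%N by rewrite !size_filter count_predC size_iota.
set g := meixner_jet a y w; set g' := meixner_jet a (- y) w'.
pose z x v := dual_coef a K1 K2 x * g' (dual_index K1 K2 x) v.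
set s := tagged_rows A1 A2; pose t := tagged_rows (rev B1) (rev B2).
have szs : size s = (size A1 + size A2)%N by rewrite size_cat !size_map.
have szt : size t = (size B1 + size B2)%N by rewrite size_cat !size_map !size_rev.
have szst : (size s + size t)%N = (K1 + K2)%N by rewrite szs szt szK1 szK2; lia.
have perm_st : perm_eq (s ++ t) (tagged_rows (iota 0 K1) (iota 0 K2)).
  rewrite /s /t /tagged_rows -catA perm_sym.
  apply: (@perm_trans _ (([seq (true, n) | n <- A1] ++ [seq (true, n) | n <- rev B1])
     ++ ([seq (false, n) | n <- A2] ++ [seq (false, n) | n <- rev B2]))).
    rewrite -!map_cat; apply: perm_cat; apply: perm_map; rewrite perm_sym.
      by rewrite (perm_trans _ (permEl (perm_filterC P1 _))) // perm_cat2l perm_rev.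
    by rewrite (perm_trans _ (permEl (perm_filterC P2 _))) // perm_cat2l perm_rev.
  by rewrite -catA perm_cat2l perm_catCA.
have pairing u v : (u + v < size s + size t)%N ->
    \sum_(x <- s ++ t) g x u * z x v = ((u + v).+1 == size s + size t)%N%:R.
  by rewrite szst (perm_big _ perm_st); apply: meixner_jet_pairing.
have := complementary_minor pairing.
have -> : rowdet (map z t) = (alpha a K2 ^+ size B1 * beta a K1 K2 ^+ size B2)%:P *
   rowdet (map g' (tagged_rows [seq (K1.-1 - i)%N | i <- rev B1]
                  [seq (K2.-1 - i)%N | i <- rev B2])).
  rewrite /z (rowdet_scale _ (dual_coef a K1 K2) (fun x => g' (dual_index K1 K2 x))).
  congr (_ * rowdet _).
    rewrite big_cat !big_map /= !prodr_const_list !size_rev -!polyC_exp -polyCM.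
    by [].
  by rewrite /t /tagged_rows !map_cat -!map_comp.
have -> : rowdet (map g (s ++ t)) =
  (-1) ^+ (size A2 * size B1 + (\sum_(i <- A1) i + 'C(size A1, 2)
            + (\sum_(i <- A2) i + 'C(size A2, 2))) + 'C(size B1, 2) + 'C(size B2, 2)) *
  rowdet (map g (tagged_rows (iota 0 K1) (iota 0 K2))).
  have -> : map g (s ++ t) = map (fun n => g (true, n)) A1 ++
     map (fun n => g (false, n)) A2 ++ map (fun n => g (true, n)) (rev B1) ++
     (map (fun n => g (false, n)) (rev B2) ++ [::]).
    by rewrite /s /t /tagged_rows !map_cat -!map_comp cats0 -!catA.
  rewrite rowdet_move_block !size_map size_rev.
  rewrite (rowdet_shuffle (fun n => g (true, n)) P1 K1 [::]).
  rewrite cat0s (rowdet_shuffle (fun n => g (false, n)) P2 K2 _ [::]) !mulrA -!exprD.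
  congr (_ ^+ _ * rowdet _); first by rewrite -/A1 -/A2 -/B1 -/B2; lia.
  by rewrite cats0 /tagged_rows map_cat -!map_comp.
rewrite confluent_det // szt.
set S := (_ + _ + (_ + _))%N; move=> E.
set G := rowdet (map g s) in E *; set G' := rowdet (map g' _) in E *.
have -> : G = (-1) ^+ 'C(size B1 + size B2, 2) *
    ((-1) ^+ 'C(size B1 + size B2, 2) * G).
  by rewrite mulrA -expr2 sqrr_sign mul1r.
rewrite -E -dual_const // -szK1 -szK2.
have sgn n : ((-1) ^+ n)%:P = (-1) ^+ n :> {poly K}.
  by rewrite polyC_exp polyCN.
by rewrite -/(alpha a K2) -/(beta a K1 K2) [in RHS]exprD !polyCM !sgn -!mulrA.
Qed.

End Core.

(** * The involution on finite sets *)

Section Sets.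
Implicit Types F : {fset nat}.

(** One more than the maximum of F, where the maximum of the empty set is -1. *)
Definition fset_bound F : nat :=
  if F == fset0 then 0 else (\max_(f <- enum_fset F) f).+1.

Definition fset_gaps F : seq nat :=
  [seq n <- iota 0 (fset_bound F) | n \notin F].

Lemma fset_maxE F : fset_max F = (fset_bound F)%:Z - 1.
Proof. by rewrite /fset_max /fset_bound; case: ifP => // _; lia. Qed.

Lemma ltn_fset_bound F n : n \in F -> (n < fset_bound F)%N.
Proof.
move=> nF; rewrite /fset_bound; case: eqP => [F0|_]; first by rewrite F0 in nF.
by rewrite ltnS (leq_bigmax_seq (F := id)).
Qed.

Lemma sort_fsetE F :
  sort leq (enum_fset F) = [seq n <- iota 0 (fset_bound F) | n \in F].
Proof.
apply: (sorted_eq leq_trans anti_leq).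
- exact: sort_sorted leq_total _.
- by apply: sorted_filter; [apply: leq_trans | apply: iota_sorted].
rewrite perm_sort; apply: uniq_perm => [||n].
- exact: fset_uniq.
- by rewrite filter_uniq // iota_uniq.
rewrite mem_filter mem_iota /= add0n andb_idr //; exact: ltn_fset_bound.
Qed.

Lemma in_invol F n : (n \in invol F) =
  (n < fset_bound F)%N && ((fset_bound F).-1 - n \notin F)%N.
Proof.
rewrite /invol; case: (eqVneq F fset0) => [->|F0].
  by rewrite /fset_bound eqxx.
have -> : fset_bound F = (\max_(f <- enum_fset F) f).+1.
  by rewrite /fset_bound (negPf F0).
set M := (\max_(f <- _) f)%N; rewrite in_fsetD in_fset mem_iota add0n andbC /=.
case: (ltnP n M.+1) => //= ltn; congr (~~ _).
apply/imfsetP/idP => [[f fF ->]|MF].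
  rewrite subKn //.
  by have := ltn_fset_bound fF; rewrite /fset_bound (negPf F0) ltnS.
by exists (M - n)%N => //; rewrite subKn.
Qed.

Lemma sort_involE F : sort leq (enum_fset (invol F)) =
  [seq ((fset_bound F).-1 - n)%N | n <- rev (fset_gaps F)].
Proof.
set K := fset_bound F.
have ltK n : n \in fset_gaps F -> (n <= K.-1)%N.
  by rewrite mem_filter mem_iota /= add0n -/K => /andP[_]; case: (K).
apply: (sorted_eq leq_trans anti_leq).
- exact: sort_sorted leq_total _.
- rewrite map_rev rev_sorted; apply: (@homo_sorted _ _ _ leq).
    by move=> i j ij; apply: leq_sub2l.
  by apply: sorted_filter; [apply: leq_trans | apply: iota_sorted].
rewrite perm_sort; apply: uniq_perm => [||n].
- exact: fset_uniq.
- rewrite map_inj_in_uniq ?rev_uniq ?filter_uniq ?iota_uniq //.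
  move=> i j; rewrite !mem_rev => /ltK iK /ltK jK eq.
  by rewrite -(subKn iK) eq subKn.
rewrite in_invol -/K; apply/idP/mapP; first move=> /andP[ltn nF].
  have leK : (n <= K.-1)%N by case: (K) ltn.
  exists (K.-1 - n)%N; last by rewrite subKn.
  rewrite mem_rev mem_filter nF mem_iota /= add0n -/K.
  by move: ltn leK; case: (K) => // k _ _; rewrite ltnS leq_subr.
move=> [i iG ->]; move: iG; rewrite mem_rev => iG; rewrite subKn ?ltK //; move: iG.
rewrite mem_filter mem_iota /= add0n -/K => /andP[-> ]; rewrite andbT.
by case: (K) => // k _; rewrite ltnS leq_subr.
Qed.

Lemma card_fset_sort F : #|` F| = size (sort leq (enum_fset F)).
Proof. by rewrite size_sort. Qed.

End Sets.

(** * Meixner polynomials *)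

Lemma rowdet_morph (R S : comNzRingType) (f : {rmorphism R -> S})
    (r : seq (nat -> R)) :
  f (rowdet r) = rowdet [seq (fun u => f (x u)) | x <- r].
Proof.
rewrite -det_map_mx (rowdetE (size_map _ _)); congr (\det _).
by apply/matrixP => i j; rewrite !mxE (nth_map (fun=> 0)).
Qed.

Lemma weightE (F : {fset nat}) (s := sort leq (enum_fset F)) :
  weight F = (\sum_(n <- s) n)%N%:Z - 'C(size s, 2)%:Z.
Proof.
by rewrite /weight card_fset_sort; congr (Posz _ - _); apply: perm_big;
  rewrite perm_sym perm_sort.
Qed.

Section Meixner.
Variables (K : fieldType) (a : K).
Hypotheses (char0 : [pchar K] =i pred0) (a_neq0 : a != 0) (a_neq1 : a != 1).
Implicit Types (c s t b : K) (y w q : {poly K}).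

(** The generating function of the Meixner polynomials. *)
Lemma meixnerE b c n : b != 0 ->
  meixner b c n =
  gseries ((1 - b)^-1)%:P (b / (1 - b))%:P 'X (- 'X - c%:P) n.
Proof.
move=> b0; rewrite /meixner /gseries /conv scaler_sumr; apply: eq_bigr => j _.
rewrite /bseries -!polyC_exp mulrACA -polyCM mul_polyC scalerA; congr (_ *: _).
have le_jn : (j <= n)%N by rewrite -ltnS.
have split (x : K) : x ^+ n = x ^+ j * x ^+ (n - j) by rewrite -exprD subnKC.
rewrite !split exprMn !exprVn invfM.
rewrite [LHS](_ : _ = b ^+ j / b ^+ j *
   ((1 - b) ^- j * (b ^+ (n - j) * (1 - b) ^- (n - j)))); last by ring.
by rewrite divff ?mul1r // expf_neq0.
Qed.

Lemma gseries_comp s t y w n q :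
  gseries s%:P t%:P y w n \Po q = gseries s%:P t%:P (y \Po q) (w \Po q) n.
Proof.
rewrite /gseries /conv rmorph_sum /bseries; apply: eq_bigr => j _ /=.
by rewrite !comp_polyM !pbinom_comp -!polyC_exp !comp_polyC.
Qed.

Lemma jet_comp b s t y w n u q :
  jet b%:P s%:P t%:P y w n u \Po q =
  jet b%:P s%:P t%:P (y \Po q) (w \Po q) n u.
Proof.
rewrite /jet comp_polyM gseries_comp -polyC_exp comp_polyC comp_polyD comp_polyB.
by rewrite -polyC_natr comp_polyC.
Qed.

Lemma meixner_jet_comp y w x u q :
  meixner_jet a y w x u \Po q = meixner_jet a (y \Po q) (w \Po q) x u.
Proof. by case: x => [] [] n; rewrite /meixner_jet /= -?polyC1 jet_comp. Qed.

Lemma det_casorati c (F1 F2 : {fset nat}) :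
  \det (casorati_mx a c F1 F2) =
  rowdet (map (meixner_jet a 'X (- 'X - c%:P))
     (tagged_rows (sort leq (enum_fset F1)) (sort leq (enum_fset F2)))).
Proof.
rewrite (@rowdetE _ (#|` F1| + #|` F2|)); last first.
  by rewrite size_map size_cat !size_map !size_sort.
have E j : ('X \Po ('X + j%:R) = 'X + j%:R :> {poly K}) *
    ((- 'X - c%:P) \Po ('X + j%:R) = - 'X - c%:P - j%:R :> {poly K}).
  split; first by rewrite comp_polyX.
  by rewrite comp_polyB comp_polyC rmorphN /= comp_polyX; ring.
congr (\det _); apply/matrixP => i j; rewrite [RHS]mxE.
rewrite /casorati_mx /tagged_rows map_cat -!map_comp nth_cat size_map size_sort.
case: (split_ordP i) => i' ->; rewrite ?col_mxEu ?col_mxEd mxE /=.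
  rewrite (nth_map 0%N) ?size_sort //= meixnerE // gseries_comp !E.
  by rewrite /meixner_jet /jet /= expr1n mul1r.
rewrite addKn (nth_map 0%N) ?size_sort //=.
rewrite meixnerE ?invr_eq0 // gseries_comp !E /meixner_jet /jet /=.
rewrite -polyC_exp mul_polyC exprVn.
have q0 : 1 - a != 0 by rewrite subr_eq0 eq_sym.
(* Passing from a to 1/a turns p = 1 / (1 - a) into - a p. *)
have e1 : (1 - a^-1)^-1 = - (a * (1 - a)^-1).
  have -> : 1 - a^-1 = - ((1 - a) / a).
    by rewrite mulrBl divff // mul1r opprB.
  by rewrite invrN invf_div.
by rewrite e1 mulrN mulKf.
Qed.

Lemma sign_weight (x : int) (m n : nat) : x = m%:Z - n%:Z ->
  (-1) ^ x = (-1) ^+ (m + n) :> K.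
Proof.
move=> ->; rewrite expfzDr ?oppr_eq0 ?oner_eq0 // -invr_expz -!exprnP exprD.
by rewrite -exprVn invrN1.
Qed.

Lemma quasi_casorati_meixner_invol (c : K) (F : {fset nat} * {fset nat}) :
  quasi_casorati_meixner a c F =
    (-1) ^ weight_pair F *:
      (quasi_casorati_meixner a
         (- c - (fset_max F.1)%:~R - (fset_max F.2)%:~R) (invol_pair F)
       \Po (- 'X)).
Proof.
case: F => F1 F2 /=; set c' := - c - _ - _.
have q0 : 1 - a != 0 by rewrite subr_eq0 eq_sym.
have norm0 k1 k2 : casorati_norm a k1 k2 != 0.
  by rewrite mulf_neq0 ?expfz_neq0 ?expf_neq0.
rewrite /quasi_casorati_meixner /= -!/(casorati_norm _ _ _).
rewrite comp_polyZ scalerA !det_casorati rowdet_morph -map_comp /=.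
rewrite !card_fset_sort !sort_involE !size_map !size_rev !sort_fsetE.
set A1 := filter _ _; set A2 := filter _ _.
set K1 := fset_bound F1; set K2 := fset_bound F2.
rewrite (eq_rowdet (s := tagged_rows (map _ _) _)
   (g := meixner_jet a (- 'X) ('X - c'%:P))); last first.
  move=> x _ u /=; rewrite meixner_jet_comp comp_polyB comp_polyC rmorphN /=.
  by rewrite comp_polyX opprK.
have := @rowdet_duality K a char0 a_neq0 a_neq1 (fun n => n \in F1)
  (fun n => n \in F2) K1 K2 'X (- 'X - c%:P) ('X - c'%:P).
rewrite /= -/A1 -/A2 -/(fset_gaps F1) -/(fset_gaps F2) => ->; last first.
  rewrite /c' !fset_maxE -/K1 -/K2 !polyCB !polyCN !rmorphB /=.
  rewrite ?polyCB -!pmulrn ?polyC_natr natrD ?polyC1; ring.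
rewrite mul_polyC scalerA; congr (_ *: _).
rewrite (@sign_weight _ (\sum_(i <- A1) i + \sum_(i <- A2) i)%N
   ('C(size A1, 2) + 'C(size A2, 2))%N); last first.
  by rewrite /weight_pair !weightE !sort_fsetE !PoszD; ring.
by rewrite addnACA mulrCA mulKf.
Qed.

End Meixner.

Local Open Scope complex_scope.

Theorem theorem5p1 (R : realType) (a c : R[i]) (F : {fset nat} * {fset nat})
    (a_neq0 : a != 0) (a_neq1 : a != 1) :
  quasi_casorati_meixner a c F =
    (-1) ^ weight_pair F *:
      (quasi_casorati_meixner a
         (- c - (fset_max F.1)%:~R - (fset_max F.2)%:~R) (invol_pair F)
       \Po (- 'X)).
Proof. exact: (quasi_casorati_meixner_invol (@Num.Theory.pchar_num _)). Qed.
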